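(* Let $A$ and $B$ be skew shapes. If $\mathrm{supp}_F(A) \supseteq \mathrm{supp}_F(B)$, then the following three equivalent conditions are true: (1) $\mathrm{rows}_k(A) \preceq \mathrm{rows}_k(B)$ for all $k\ge 1$; (2) $\mathrm{cols}_\ell(A) \preceq \mathrm{cols}_\ell(B)$ for all $\ell\ge 1$; (3) $\mathrm{rects}_{k,\ell}(A) \le \mathrm{rects}_{k,\ell}(B)$ for all $k,\ell\ge 1$.
   Context: A composition of $n$ is a sequence of positive integers with sum $n$; a partition is a weakly decreasing composition. Compositions $\alpha=(\alpha_1,\dots,\alpha_k)$ of $n$ correspond bijectively to subsets of $[n-1]=\{1,\dots,n-1\}$ via $S(\alpha)=\{\alpha_1,\alpha_1+\alpha_2,\dots,\alpha_1+\cdots+\alpha_{k-1}\}$. Young diagrams are left-justified with row $1$ at the top; a skew shape $\lambda/\mu$ is the Young diagram of $\lambda$ with the boxes of $\mu\subseteq\lambda$ removed from its top-left. A standard Young tableau (SYT) of a skew shape $A$ with $n$ boxes is a filling of the boxes by $1,\dots,n$, each used once, increasing left to right along rows and down columns. Its descent set is the set of $i$ such that $i+1$ appears in a strictly lower row than $i$, and its descent composition is the composition of $n$ corresponding to its descent set. The monomial quasisymmetric functions are $M_\alpha=\sum_{i_1<\cdots<i_k}x_{i_1}^{\alpha_1}\cdots x_{i_k}^{\alpha_k}$, and the fundamental quasisymmetric functions are $F_\alpha=\sum_{S(\alpha)\subseteq S(\beta)\subseteq[n-1]}M_\beta$ for $\alpha$ of size $n$. The skew Schur function is $s_A=\sum_T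 F_{\mathrm{comp}(T)}$, the sum being over all SYT $T$ of shape $A$, where $\mathrm{comp}(T)$ is the descent composition of $T$. The $F$-support $\mathrm{supp}_F(A)$ is the set of compositions $\alpha$ such that $F_\alpha$ has positive coefficient in $s_A$ (equivalently, such that some SYT of shape $A$ has descent composition $\alpha$). For a skew shape $A$ with $r$ rows and $1\le i\le r-k+1$, let $\mathrm{overlap}_k(i)$ be the number of columns occupied in common by rows $i,i+1,\dots,i+k-1$; $\mathrm{rows}_k(A)$ is the partition obtained by sorting $(\mathrm{overlap}_k(1),\dots,\mathrm{overlap}_k(r-k+1))$ into weakly decreasing order and omitting zeros (so it is the empty partition if there are no nonzero overlaps). $\mathrm{cols}_\ell(A)$ is defined in the same way with the roles of rows and columns exchanged. $\mathrm{rects}_{k,\ell}(A)$ is the number of $k\times\ell$ rectangular subdiagrams ($k$ rows, $\ell$ columns, consecutive) contained in $A$. Dominance order, for partitions possibly of different sizes: $\lambda=(\lambda_1,\dots,\lambda_r)\preceq\mu=(\mu_1,\dots,\mu_s)$ if $\lambda_1+\cdots+\lambda_k\le\mu_1+\cdots+\mu_k$ for all $k=1,\dots,r$, where $\mu_i=0$ for $i>s$. *)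

(* Defs.v *)
From mathcomp Require Import all_boot all_order all_algebra finmap zify.
Set Implicit Arguments.
Unset Strict Implicit.
Unset Printing Implicit Defensive.
Import GRing.Theory Num.Theory.

Definition is_comp (a : seq nat) : bool := 0 \notin a.

Definition is_part (a : seq nat) : bool := is_comp a && sorted geq a.

(* A composition of n has at most n parts, all at most n, so the bounded
   sequences below exhaust the compositions of n (see [mem_comps]). *)
Definition comps (n : nat) : seq (seq nat) :=
  [seq a <- [seq map val (val b) | b : n.-bseq 'I_n.+1]
     | is_comp a && (sumn a == n)].

(* S(a) = {a_1, a_1 + a_2, ..., a_1 + ... + a_(k-1)}, k = size a *)
Definition comp_set (a : seq nat) : seq nat :=
  [seq sumn (take j a) | j <- iota 1 (size a).-1].

(* The composition of n whose associated subset of [n-1] is the set of terms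
   of the increasing sequence d (see [comp_ofK]); the only composition of 0
   is the empty one. *)
Definition comp_of (n : nat) (d : seq nat) : seq nat :=
  if n is 0 then [::] else pairmap (fun x y => y - x) 0 (rcons d n).

Definition dominated (a b : seq nat) : Prop :=
  forall k, 1 <= k <= size a ->
    \sum_(i < k) nth 0 a i <= \sum_(i < k) nth 0 b i.

Record skew_shape := SkewShape {
  outer : seq nat;
  inner : seq nat;
  outer_part : is_part outer;
  inner_part : is_part inner;
  inner_sub : forall i, nth 0 inner i <= nth 0 outer i
}.

(* Rows and columns are numbered from 0: (i, j) is the box in row i + 1 and
   column j + 1. *)
Definition in_shape (A : skew_shape) (i j : nat) : bool :=
  nth 0 (inner A) i <= j < nth 0 (outer A) i.

Definition nrows (A : skew_shape) : nat := size (outer A).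
Definition ncols (A : skew_shape) : nat := head 0 (outer A).

Definition box (A : skew_shape) : finType :=
  {x : 'I_(nrows A) * 'I_(ncols A) | in_shape A x.1 x.2}.

Definition boxrow (A : skew_shape) (x : box A) : nat := (val x).1.
Definition boxcol (A : skew_shape) (x : box A) : nat := (val x).2.

Definition nboxes (A : skew_shape) : nat := #|box A|.

Definition filling (A : skew_shape) : finType := {ffun box A -> 'I_(nboxes A)}.

(* Entries are numbered from 1. *)
Definition entry (A : skew_shape) (T : filling A) (x : box A) : nat := (T x).+1.

(* An injective filling uses each of 1, ..., n exactly once, since the shape
   has n boxes. *)
Definition is_SYT (A : skew_shape) (T : filling A) : bool :=
  [&& injectiveb T,
      [forall x : box A, forall y : box A,
        (boxrow x == boxrow y) && (boxcol x < boxcol y)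
          ==> (entry T x < entry T y)]
    & [forall x : box A, forall y : box A,
        (boxcol x == boxcol y) && (boxrow x < boxrow y)
          ==> (entry T x < entry T y)]].

Definition is_descent (A : skew_shape) (T : filling A) (i : nat) : bool :=
  [exists x : box A, exists y : box A,
    [&& entry T x == i, entry T y == i.+1 & boxrow x < boxrow y]].

Definition descents (A : skew_shape) (T : filling A) : seq nat :=
  [seq i <- iota 1 (nboxes A).-1 | is_descent T i].

Definition descent_comp (A : skew_shape) (T : filling A) : seq nat :=
  comp_of (nboxes A) (descents T).

(* The monomial prod_i x_i ^ (m i), given by its exponents. *)
Definition monomial := {fsfun nat -> nat with 0}.

(* Formal power series in x_0, x_1, ... over the integers, given by their
   coefficients. *)
Definition series := monomial -> int.

(* The nonzero exponents of m, listed by increasing index of the variable. *)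
Definition exponents (m : monomial) : seq nat :=
  [seq m i | i <- sort leq (finsupp m)].

(* The monomial x_(i_1)^(a_1) ... x_(i_k)^(a_k) with i_1 < ... < i_k arises
   from exactly one sequence of indices, so its coefficient in M_a is 1. *)
Definition qM (a : seq nat) : series :=
  fun m => ((exponents m == a)%:R)%R.

Definition qF (a : seq nat) : series :=
  fun m =>
    (\sum_(b <- comps (sumn a) | all [in comp_set b] (comp_set a)) qM b m)%R.

Definition skew_schur (A : skew_shape) : series :=
  fun m => (\sum_(T : filling A | is_SYT T) qF (descent_comp T) m)%R.

(* The functions F_a, for a composition, are linearly independent, so that the
   coefficients c of the expansion are determined by A. *)
Definition supp_F (A : skew_shape) (a : seq nat) : Prop :=
  exists (r : seq (seq nat)) (c : seq nat -> int),
    [/\ uniq r, all is_comp r,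
        forall m, skew_schur A m = (\sum_(b <- r) c b * qF b m)%R,
        a \in r & (0 < c a)%R].

Definition row_overlap (k : nat) (A : skew_shape) (i : nat) : nat :=
  count (fun j => all (fun i' => in_shape A i' j) (iota i k))
        (iota 0 (ncols A)).

Definition col_overlap (l : nat) (A : skew_shape) (j : nat) : nat :=
  count (fun i => all (fun j' => in_shape A i j') (iota j l))
        (iota 0 (nrows A)).

(* With r rows, the 0-based index of the first of k consecutive rows ranges
   over 0, ..., r - k, and there is none when k > r. *)
Definition rows_ (k : nat) (A : skew_shape) : seq nat :=
  sort geq [seq x <- [seq row_overlap k A i | i <- iota 0 ((nrows A).+1 - k)]
              | 0 < x].

Definition cols_ (l : nat) (A : skew_shape) : seq nat :=
  sort geq [seq x <- [seq col_overlap l A j | j <- iota 0 ((ncols A).+1 - l)]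
              | 0 < x].

(* A k x l rectangle is given by its top left box. *)
Definition rects (k l : nat) (A : skew_shape) : nat :=
  #|[set p : 'I_(nrows A) * 'I_(ncols A) |
      all (fun i => all (fun j => in_shape A i j) (iota p.2 l)) (iota p.1 k)]|.

Definition rows_cond (A B : skew_shape) : Prop :=
  forall k, 1 <= k -> dominated (rows_ k A) (rows_ k B).

Definition cols_cond (A B : skew_shape) : Prop :=
  forall l, 1 <= l -> dominated (cols_ l A) (cols_ l B).

Definition rects_cond (A B : skew_shape) : Prop :=
  forall k l, 1 <= k -> 1 <= l -> rects k l A <= rects k l B.

Lemma mem_comps n a : (a \in comps n) = is_comp a && (sumn a == n).
Proof.
rewrite mem_filter; apply: andb_idr => /andP[ca /eqP sa].
have le_sum x : x \in a -> x <= sumn a.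
  by elim: (a) => //= y s IH; rewrite inE => /orP[/eqP->|/IH]; lia.
have sz : size a <= n.
  rewrite -sa; elim: (a) ca => //= y s IH.
  by rewrite /is_comp inE negb_or => /andP[y0 /IH]; lia.
have szi : size (map (@inord n) a) <= n by rewrite size_map.
apply/mapP; exists (Bseq szi); first by rewrite mem_enum.
rewrite /= -map_comp -[LHS]map_id; apply/eq_in_map => x /le_sum xa /=.
by rewrite inordK // ltnS -sa.
Qed.

Lemma comps_uniq n : uniq (comps n).
Proof.
rewrite filter_uniq // map_inj_uniq ?enum_uniq // => b1 b2 e.
by apply/val_inj/(inj_map val_inj).
Qed.

Lemma sumn_take_pairmap p s i : path leq p s -> i < size s ->
  sumn (take i.+1 (pairmap (fun x y => y - x) p s)) = nth 0 s i - p.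
Proof.
elim: s p i => [|x s IH] p [|i] //= /andP[px xs] si; first by rewrite take0 /=; lia.
rewrite IH //.
have /allP/(_ (nth 0 s i) (mem_nth 0 si)) := order_path_min leq_trans xs.
lia.
Qed.

Lemma comp_ofK n d : 0 < n -> sorted ltn d -> all (fun i => 0 < i < n) d ->
  [/\ is_comp (comp_of n d), sumn (comp_of n d) = n
    & comp_set (comp_of n d) = d].
Proof.
case: n => // n _ sd bd; rewrite /comp_of; set s := rcons d n.+1.
have lt0s : path ltn 0 s.
  rewrite rcons_path; apply/andP; split.
    by case: (d) sd bd => //= x t -> /andP[/andP[-> _] _].
  by case/lastP: (d) bd => // t x; rewrite all_rcons last_rcons => /andP[/andP[]].
have le0s : path leq 0 s by apply: sub_path lt0s => x y /ltnW.
have ss : size s = (size d).+1 by rewrite size_rcons.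
split.
- elim: (s) (0) lt0s => //= x t IH p /andP[px /IH].
  by rewrite /is_comp inE negb_or => ->; rewrite andbT; lia.
- rewrite -[X in sumn X]take_size size_pairmap ss sumn_take_pairmap ?ss //.
  by rewrite nth_rcons ltnn eqxx subn0.
- apply: (@eq_from_nth _ 0); rewrite size_map size_iota size_pairmap ss // => i id.
  rewrite /comp_set (nth_map 0) size_pairmap ss ?size_iota // nth_iota // add1n.
  by rewrite sumn_take_pairmap ?ss 1?ltnW // subn0 nth_rcons id.
Qed.

(* Main.v *)
(* Fix k, l >= 1 and fill B greedily: first the l - 1 leftmost boxes of every row,
   as vertical strips read downwards, then the k - 1 topmost boxes of every
   remaining column, as horizontal strips read from left to right, then the rest
   in any order. The boxes of the rest are exactly the bottom right corners of
   the k x l rectangles of B. An SYT of A with the same descent set is cut into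
   l - 1 vertical strips, k - 1 horizontal strips and a rest of the same size.
   A vertical strip meets a row at most once and a horizontal strip meets a column
   at most once, so the bottom right corner of a k x l rectangle of A avoids them:
   follow its top row, then its last column. Hence rects_{k,l}(A) <= rects_{k,l}(B).

   The rows_k (and the cols_l) conditions are equivalent to the rects conditions
   because rects_{k,l} is the sum of max(x - (l - 1), 0) over the parts x of
   rows_k, and weak majorization is tested by such functions. *)

Require Import Defs.
From mathcomp Require Import all_boot all_order all_algebra finmap zify.
Set Implicit Arguments.
Unset Strict Implicit.
Unset Printing Implicit Defensive.
Import GRing.Theory Num.Theory.

(** * Weak majorization *)

Lemma leq_nth_geq s i j : sorted geq s -> i <= j -> nth 0 s j <= nth 0 s i.
Proof.
move=> ss ij; case: (ltnP j (size s)) => sj; last by rewrite nth_default.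
have geq_tr : transitive geq by move=> x y z /= h1 h2; apply: leq_trans h2 h1.
by apply: (sorted_leq_nth geq_tr leqnn 0 ss); rewrite ?inE ?(leq_ltn_trans ij sj).
Qed.

Lemma sum_excess_nth s t N : size s <= N ->
  \sum_(x <- s) (x - t) = \sum_(i < N) (nth 0 s i - t).
Proof.
move=> sN; rewrite (big_nth 0) big_mkord.
rewrite (big_ord_widen N (fun i => nth 0 s i - t) sN) big_mkcond.
by apply: eq_bigr => i _; case: ltnP => // /(nth_default 0) ->.
Qed.

Lemma leq_sum_nth s p N t : p <= N ->
  \sum_(i < p) (nth 0 s i - t) <= \sum_(i < N) (nth 0 s i - t).
Proof.
move=> pN; rewrite (big_ord_widen N (fun i => nth 0 s i - t) pN) big_mkcond.
by apply: leq_sum => i _; case: ifP.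
Qed.

Lemma leq_sum_excess s p t :
  \sum_(i < p) nth 0 s i <= \sum_(i < p) (nth 0 s i - t) + p * t.
Proof.
rewrite -[p in p * t]card_ord -sum_nat_const -big_split.
by apply: leq_sum => i _ /=; lia.
Qed.

Lemma sum_excess_prefix s p N t : sorted geq s -> p <= N -> nth 0 s p <= t ->
  \sum_(i < N) (nth 0 s i - t) = \sum_(i < p) (nth 0 s i - t).
Proof.
move=> ss pN st; rewrite (big_ord_widen N (fun i => nth 0 s i - t) pN) [RHS]big_mkcond.
apply: eq_bigr => i _; case: ltnP => // /(leq_nth_geq ss); lia.
Qed.

Lemma sum_excess_exact s p t : (forall i, i < p -> t <= nth 0 s i) ->
  \sum_(i < p) nth 0 s i = \sum_(i < p) (nth 0 s i - t) + p * t.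
Proof.
move=> h; rewrite -[p in p * t]card_ord -sum_nat_const -big_split.
by apply: eq_bigr => i _ /=; rewrite subnK // h.
Qed.

(** For decreasing [a], the excess sum over [t] is the maximum over [p] of the sum of the first [p]
    parts minus [p * t], so prefix sums and excess sums are related by convex duality. *)
Lemma dominated_excessP a b : sorted geq a -> sorted geq b ->
  dominated a b <-> forall t, \sum_(x <- a) (x - t) <= \sum_(x <- b) (x - t).
Proof.
move=> sa sb; split=> [dom t|ex p /andP[p0 pa]].
  (* [p] is the number of parts of [a] above [t]: their excess is exact, that of the others
     vanishes. *)
  set p := find (leq^~ t) a.
  have pa : p <= size a by apply: find_size.
  rewrite !(@sum_excess_nth _ _ (size a + size b)) ?leq_addr ?leq_addl //.
  rewrite (@sum_excess_prefix a p) //; [|lia|]; last first.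
    case: (ltnP p (size a)) => h; last by rewrite nth_default.
    by apply: (@nth_find _ 0 (leq^~ t)); rewrite has_find.
  apply: leq_trans (@leq_sum_nth b p _ t _); last lia.
  have ha : \sum_(i < p) nth 0 a i = \sum_(i < p) (nth 0 a i - t) + p * t.
    apply: sum_excess_exact => i /(before_find 0) /negbT; lia.
  have hb := leq_sum_excess b p t.
  case: (posnP p) => [->|p0]; first by rewrite !big_ord0.
  have := dom p; rewrite p0 pa => /(_ isT); lia.
(* At this threshold the first [p] excesses of [b] are exact and the later ones vanish; the default
   [t = 0] covers [p >= size b]. *)
set t := nth 0 b p.
have := ex t; rewrite !(@sum_excess_nth _ _ (size a + size b)) ?leq_addr ?leq_addl //.
rewrite (@sum_excess_prefix b p) //; last lia.
have ha := leq_sum_excess a p t.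
have ha' : \sum_(i < p) (nth 0 a i - t) <= \sum_(i < size a + size b) (nth 0 a i - t).
  by apply: leq_sum_nth; lia.
have := @sum_excess_exact b p t (fun i ip => leq_nth_geq sb (ltnW ip)); lia.
Qed.

Lemma count_itv a b N :
  count (fun x => a <= x < b) (iota 0 N) = minn b N - a.
Proof.
elim: N => [|N IH]; first by rewrite minn0.
by rewrite -addn1 iotaD count_cat IH /=; lia.
Qed.

Lemma sum_ord_pred N (P : pred nat) : \sum_(i < N) (P i : nat) = count P (iota 0 N).
Proof.
by rewrite -(big_mkord xpredT (fun i => nat_of_bool (P i))) /index_iota subn0
  -sumn_count sumnE big_map.
Qed.

(** * Overlaps and rectangles *)

(** Zeros have no excess, so the sorting and filtering in [rows_] and [cols_] can be ignored. *)
Lemma sum_sort_pos (s : seq nat) t :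
  \sum_(x <- sort geq [seq x <- s | 0 < x]) (x - t) = \sum_(x <- s) (x - t).
Proof.
rewrite (perm_big _ (permEl (perm_sort _ _))) big_filter big_mkcond.
by apply: eq_bigr => -[].
Qed.

Lemma sum_iota_ord (f : nat -> nat) m n : m <= n ->
    (forall i, m <= i -> f i = 0) ->
  \sum_(i <- iota 0 m) f i = \sum_(i < n) f i.
Proof.
move=> mn f0; rewrite -(big_mkord xpredT f) (@big_cat_nat _ _ _ m) //= /index_iota subn0.
rewrite -[LHS]addn0; congr addn.
by rewrite big1_seq // => i; rewrite mem_iota => /andP[_ /andP[/f0]].
Qed.

(** Stands in for conjugate partitions: in a fixed column, a lower bound on [inner] or [outer] holds
    exactly for the first [c] rows. *)
Lemma initial_segment (P : pred nat) N :
    (forall i j, i <= j -> P j -> P i) -> (forall i, P i -> i < N) ->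
  exists2 c, c <= N & forall i, P i = (i < c).
Proof.
move=> Pm PN; have exN : exists c, ~~ P c.
  by exists N; apply/negP => /PN; rewrite ltnn.
case: (ex_minnP exN) => c Pc cmin; exists c.
  by apply: cmin; apply/negP => /PN; rewrite ltnn.
move=> i; case: ltnP => [ic|ci]; last by apply/negP => /(Pm _ _ ci); apply/negP.
by apply: contraLR ic => /cmin; rewrite -leqNgt.
Qed.

Section Overlaps.

Variable A : skew_shape.

Lemma leq_outer i j : i <= j -> nth 0 (outer A) j <= nth 0 (outer A) i.
Proof. by apply: leq_nth_geq; case/andP: (outer_part A). Qed.

Lemma leq_inner i j : i <= j -> nth 0 (inner A) j <= nth 0 (inner A) i.
Proof. by apply: leq_nth_geq; case/andP: (inner_part A). Qed.

Lemma outer_ncols i : nth 0 (outer A) i <= ncols A.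
Proof. by rewrite /ncols -nth0 leq_outer. Qed.

Lemma outer_nrows i : nrows A <= i -> nth 0 (outer A) i = 0.
Proof. exact: nth_default. Qed.

Definition is_rect k l i j : bool :=
  all (fun i' => all (fun j' => in_shape A i' j') (iota j l)) (iota i k).

(** As [inner] and [outer] decrease, the left bound is tightest in the top row and the right bound
    in the bottom row. *)
Lemma is_rectE k l i j : 0 < k -> 0 < l ->
  is_rect k l i j =
  (nth 0 (inner A) i <= j) && (j + l.-1 < nth 0 (outer A) (i + k.-1)).
Proof.
move=> k0 l0; apply/allP/andP => [h|[hi ho] i']; last first.
  rewrite mem_iota => /andP[ii ik]; apply/allP => j'; rewrite mem_iota => /andP[jj jl].
  have := leq_inner ii; have : i' <= i + k.-1 by lia.
  by move=> /leq_outer; rewrite /in_shape; lia.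
have hh i' j' : i <= i' < i + k -> j <= j' < j + l -> in_shape A i' j'.
  move=> hi hj; have hi' : i' \in iota i k by rewrite mem_iota.
  by move/allP: (h _ hi'); apply; rewrite mem_iota.
have : in_shape A i j by apply: hh; lia.
have : in_shape A (i + k.-1) (j + l.-1) by apply: hh; lia.
by rewrite /in_shape; lia.
Qed.

Lemma rects_count k l :
  rects k l A = \sum_(i < nrows A) \sum_(j < ncols A) is_rect k l i j.
Proof.
rewrite pair_bigA /= /rects -sum1dep_card big_mkcond.
by apply: eq_bigr => p _; rewrite -/(is_rect _ _ _ _); case: is_rect.
Qed.

Lemma row_overlapE k i : 0 < k ->
  row_overlap k A i = nth 0 (outer A) (i + k.-1) - nth 0 (inner A) i.
Proof.
move=> k0; rewrite -[X in X - _](minn_idPl (outer_ncols _)) -count_itv.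
apply: eq_count => j; transitivity (is_rect k 1 i j); last by rewrite is_rectE // addn0.
by apply: eq_all => i' /=; rewrite andbT.
Qed.

(** The [k] rows share an interval of columns, and a rectangle is a window of [l] consecutive
    columns in it. *)
Lemma rect_row_sum k l i : 0 < k -> 0 < l ->
  \sum_(j < ncols A) is_rect k l i j = row_overlap k A i - l.-1.
Proof.
move=> k0 l0; rewrite (sum_ord_pred _ (is_rect k l i)) row_overlapE //.
have := outer_ncols (i + k.-1); set o := nth 0 (outer A) _ => on.
rewrite (@eq_count _ _ (fun j => nth 0 (inner A) i <= j < o - l.-1)); last first.
  by move=> j; rewrite is_rectE // -/o; lia.
by rewrite count_itv; lia.
Qed.

Lemma rects_rows k l : 0 < k -> 0 < l ->
  rects k l A = \sum_(x <- rows_ k A) (x - l.-1).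
Proof.
move=> k0 l0; rewrite rects_count sum_sort_pos big_map.
(* Lower starting rows have overlap 0, since the last of their [k] rows lies below the shape. *)
rewrite (@sum_iota_ord (fun i => row_overlap k A i - l.-1) _ (nrows A)); last 2 first.
- lia.
- by move=> i hi; rewrite row_overlapE // outer_nrows //; lia.
by apply: eq_bigr => i _; rewrite rect_row_sum.
Qed.

(** [a] and [b] do not depend on [k], so rectangles of heights [k] and [1] are counted in the same
    interval of rows. *)
Lemma rect_col_bounds l j : 0 < l -> exists a b,
  b <= nrows A /\ forall k i, 0 < k -> is_rect k l i j = (a <= i) && (i + k.-1 < b).
Proof.
move=> l0; have [a aN ha] : exists2 a, a <= nrows A &
    forall i, (j < nth 0 (inner A) i) = (i < a).
  apply: initial_segment => [i i' /leq_inner|i hi]; first lia.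
  have := inner_sub A i; case: (ltnP i (nrows A)) => // /outer_nrows ->; lia.
have [b bN hb] : exists2 b, b <= nrows A &
    forall i, (j + l.-1 < nth 0 (outer A) i) = (i < b).
  apply: initial_segment => [i i' /leq_outer|i]; first lia.
  by case: (ltnP i (nrows A)) => // /outer_nrows ->.
by exists a, b; split=> // k i k0; rewrite is_rectE // -hb; have := ha i; lia.
Qed.

Lemma col_overlapE l j : col_overlap l A j = \sum_(i < nrows A) is_rect 1 l i j.
Proof.
rewrite (sum_ord_pred _ (fun i => is_rect 1 l i j)).
by apply: eq_count => i; rewrite /is_rect /= andbT.
Qed.

Lemma rect_col_sum k l j : 0 < k -> 0 < l ->
  \sum_(i < nrows A) is_rect k l i j = col_overlap l A j - k.-1.
Proof.
move=> k0 l0; have [a [b [bN hab]]] := rect_col_bounds j l0.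
rewrite col_overlapE (sum_ord_pred _ (fun i => is_rect k l i j)).
rewrite (sum_ord_pred _ (fun i => is_rect 1 l i j)).
rewrite (@eq_count _ _ (fun i => a <= i < b - k.-1)); last by move=> i; rewrite hab //; lia.
rewrite (@eq_count _ (fun i => is_rect _ _ _ _) (fun i => a <= i < b)); last first.
  by move=> i; rewrite hab //; lia.
by rewrite !count_itv; lia.
Qed.

Lemma rects_cols k l : 0 < k -> 0 < l ->
  rects k l A = \sum_(x <- cols_ l A) (x - k.-1).
Proof.
move=> k0 l0; rewrite rects_count exchange_big sum_sort_pos big_map.
rewrite (@sum_iota_ord (fun j => col_overlap l A j - k.-1) _ (ncols A)); last 2 first.
- lia.
- move=> j hj; rewrite -rect_col_sum // big1 // => i _; rewrite is_rectE //.
  by have := outer_ncols (i + k.-1); lia.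
by apply: eq_bigr => i _; rewrite rect_col_sum.
Qed.

End Overlaps.

(** * Equivalence of the three conditions *)

Lemma sorted_sort_geq s : sorted geq (sort geq s).
Proof. by apply: sort_sorted => x y /=; apply: leq_total. Qed.

Lemma dominated_sortP a b : dominated (sort geq a) (sort geq b) <->
  forall t, \sum_(x <- sort geq a) (x - t) <= \sum_(x <- sort geq b) (x - t).
Proof. exact: dominated_excessP (sorted_sort_geq _) (sorted_sort_geq _). Qed.

Lemma rows_condP A B : rows_cond A B <-> rects_cond A B.
Proof.
split=> h k.
  move=> l k0 l0; rewrite !rects_rows //.
  by move: (l.-1); apply/dominated_sortP; apply: h.
move=> k0; apply/dominated_sortP => t.
by have := h k t.+1 k0 isT; rewrite !rects_rows.
Qed.

Lemma cols_condP A B : cols_cond A B <-> rects_cond A B.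
Proof.
split=> h.
  move=> k l k0 l0; rewrite !rects_cols //.
  by move: (k.-1); apply/dominated_sortP; apply: h.
move=> l l0; apply/dominated_sortP => t.
by have := h t.+1 l isT l0; rewrite !rects_cols.
Qed.

(** * Supports and tableaux *)

Lemma exponents_comp m : is_comp (exponents m).
Proof. by apply/mapP => -[i]; rewrite mem_sort mem_finsupp => /eqP h /esym. Qed.

Lemma exponents_surj a : is_comp a -> exists m, exponents m = a.
Proof.
move=> ca; pose m : monomial :=
  [fsfun i in [fset i | i in iota 0 (size a)]%fset => nth 0 a i].
have mE i : m i = nth 0 a i.
  rewrite fsfun_fun !inE /= mem_iota /= add0n.
  by case: ltnP => // /(nth_default 0) ->.
exists m; rewrite /exponents (eq_map mE).
suff -> : sort leq (finsupp m) = iota 0 (size a) by rewrite map_nth_iota0 // take_size.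
apply: (sorted_eq leq_trans anti_leq); rewrite ?iota_sorted //.
  by apply: sort_sorted => x y; apply: leq_total.
rewrite perm_sort; apply: uniq_perm; rewrite ?fset_uniq ?iota_uniq // => i.
rewrite mem_finsupp mE mem_iota /= add0n.
case: ltnP => [ia|/(nth_default 0) ->]; last by rewrite eqxx.
by apply/eqP => a0; move: ca; rewrite /is_comp -a0 mem_nth.
Qed.

(** A monomial occurs in [qM] of exactly one sequence, that of its exponents. *)
Lemma qFE b m : qF b m =
  (((sumn (exponents m) == sumn b)
    && all [in comp_set (exponents m)] (comp_set b))%:R)%R.
Proof.
rewrite /qF /qM; set e := exponents m.
case: (boolP (e \in comps (sumn b))) => [ec|enc]; last first.
  rewrite big_seq_cond big1 => [|b' /andP[b'c _]].
    by move: enc; rewrite mem_comps exponents_comp /= => /negbTE ->.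
  by case: eqP => // eb; move: enc; rewrite eb b'c.
have -> : sumn e == sumn b by move: ec; rewrite mem_comps => /andP[].
rewrite big_mkcond (bigD1_seq e) ?comps_uniq //= eqxx big1 ?addr0.
  by case: all.
by move=> b' /negbTE nb; rewrite eq_sym nb; case: ifP.
Qed.

Lemma sumn_take_ltn a i j : is_comp a -> i < j -> j <= size a ->
  sumn (take i a) < sumn (take j a).
Proof.
elim: a i j => [|x a IH] [|i] [|j] //=; rewrite /is_comp inE negb_or => /andP[x0 ca].
- by lia.
- by move=> ij ja; rewrite ltn_add2l IH.
Qed.

Lemma comp_set_sorted a : is_comp a -> sorted ltn (comp_set a).
Proof.
move=> ca; apply: (@homo_sorted_in _ _ [pred j | j <= size a] _ ltn).
- by move=> i j /= ia ja ij; apply: sumn_take_ltn.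
- by apply/allP => j; rewrite mem_iota inE; lia.
- exact: iota_ltn_sorted.
Qed.

Lemma comp_set_sub_size a b : is_comp a -> sumn a = sumn b ->
  all [in comp_set b] (comp_set a) -> size a <= size b.
Proof.
move=> ca sab /allP ab.
have := uniq_leq_size (sorted_uniq ltn_trans ltnn (comp_set_sorted ca)) ab.
rewrite !size_map !size_iota.
(* Lengths 0 and 1 give the same empty [comp_set]; the equal sums tell them apart. *)
by case: a b ca sab {ab} => [|x a] [|y b] //=; rewrite /is_comp inE; lia.
Qed.

(** Equal lengths turn the inclusion into equality of sets, hence of partial sums, hence of
    parts. *)
Lemma comp_set_sub_eq a b : is_comp a -> is_comp b -> sumn a = sumn b ->
  all [in comp_set b] (comp_set a) -> size a = size b -> a = b.
Proof.
move=> ca cb sab /allP ab szab.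
have uniq_cs c : is_comp c -> uniq (comp_set c).
  by move/comp_set_sorted/(sorted_uniq ltn_trans ltnn).
have csE : comp_set a = comp_set b.
  apply: (irr_sorted_eq ltn_trans ltnn); rewrite ?comp_set_sorted //.
  by apply: (uniq_min_size (uniq_cs a ca) ab _).2; rewrite !size_map !size_iota szab.
have takeE j : j <= size a -> sumn (take j a) = sumn (take j b).
  case: (posnP j) => [->|j0]; first by rewrite !take0.
  rewrite leq_eqVlt => /orP[/eqP ->|ja]; first by rewrite take_size szab take_size.
  have := congr1 (fun s => nth 0 s j.-1) csE.
  by rewrite !(nth_map 0) ?size_iota ?nth_iota ?add1n ?prednK //; lia.
apply: (@eq_from_nth _ 0) => // j ja.
have := takeE j.+1 ja; have := takeE j (ltnW ja).
by rewrite !(take_nth 0) -?szab // !sumn_rcons; lia.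
Qed.

(* Triangularity: if [exponents m = a], then the only [b] with [size a <= size b]
   and [qF b m != 0] is [a]. *)
Lemma qF_free (r : seq (seq nat)) (d : seq nat -> int) :
    uniq r -> all is_comp r ->
    (forall m, (\sum_(b <- r) d b * qF b m)%R = 0%R) ->
  forall a, a \in r -> d a = 0%R.
Proof.
move=> ur /allP cr r0 a; have [n] := ubnP (size a).
elim: n a => // n IH a an ar; have [m ma] := exponents_surj (cr a ar).
have := r0 m; rewrite (bigD1_seq a) //= qFE ma eqxx /=.
have -> : all [in comp_set a] (comp_set a) by apply/allP.
rewrite mulr1 big_seq_cond big1 ?addr0 // => b /andP[br ba].
rewrite qFE ma; case: andP => [[/eqP sab ab]|]; last by rewrite mulr0.
have cb := cr b br; have := comp_set_sub_size cb (esym sab) ab.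
rewrite leq_eqVlt => /orP[/eqP szab|szab]; last first.
  by rewrite IH ?mul0r //; apply: leq_trans szab an.
by move: ba; rewrite (comp_set_sub_eq cb (cr a ar) (esym sab) ab szab) eqxx.
Qed.

Section Support.

Variable A : skew_shape.

Lemma descent_compP (T : filling A) :
  [/\ is_comp (descent_comp T), sumn (descent_comp T) = nboxes A
    & comp_set (descent_comp T) = descents T].
Proof.
rewrite /descent_comp; case: (posnP (nboxes A)) => [n0|n0].
  by rewrite /descents n0.
apply: comp_ofK => //.
  by apply: sorted_filter; [exact: ltn_trans | exact: iota_ltn_sorted].
by apply/allP => i; rewrite mem_filter mem_iota; lia.
Qed.

Definition descent_count (b : seq nat) : int :=
  (#|[set T : filling A | is_SYT T & descent_comp T == b]|%:R)%R.

Lemma skew_schur_count m :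
  skew_schur A m = (\sum_(b <- comps (nboxes A)) descent_count b * qF b m)%R.
Proof.
rewrite /skew_schur.
transitivity (\sum_(T : filling A | is_SYT T) \sum_(b <- comps (nboxes A))
    (descent_comp T == b)%:R * qF b m)%R.
  apply: eq_bigr => T _; have [cT nT _] := descent_compP T.
  rewrite (bigD1_seq (descent_comp T)) ?comps_uniq ?mem_comps ?cT ?nT ?eqxx //=.
  rewrite mul1r big1 ?addr0 // => b /negbTE nb.
  by rewrite eq_sym nb mul0r.
rewrite exchange_big; apply: eq_bigr => b _; rewrite -mulr_suml; congr (_ * _)%R.
rewrite /descent_count -sum1dep_card natr_sum [RHS]big_mkcondr.
by apply: eq_bigr => T _; case: eqP.
Qed.

(** [supp_F] allows any finite expansion; linear independence forces its coefficients to be the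
    descent counts. *)
Lemma supp_FP a :
  supp_F A a <-> exists2 T : filling A, is_SYT T & descent_comp T = a.
Proof.
split=> [[r [c [ur cr rE ar ca]]]|[T ST Ta]]; last first.
  have [cT nT _] := descent_compP T.
  exists (comps (nboxes A)), descent_count; split=> //.
  - exact: comps_uniq.
  - by apply/allP => b; rewrite mem_comps => /andP[].
  - exact: skew_schur_count.
  - by rewrite -Ta mem_comps cT nT eqxx.
  - by rewrite /descent_count ltr0n; apply/card_gt0P; exists T; rewrite inE ST Ta eqxx.
have restr (s s' : seq (seq nat)) (f : seq nat -> int) : uniq s -> uniq s' ->
    {subset s <= s'} ->
    (\sum_(b <- s') (if b \in s then f b else 0) = \sum_(b <- s) f b)%R.
  move=> us us' ss; rewrite -big_mkcond -big_filter; apply: perm_big.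
  by apply: uniq_perm; rewrite ?filter_uniq // => b; rewrite mem_filter andb_idr // => /ss.
(* The two expansions are subtracted over a joint index list [s], with coefficients extended by
   0. *)
pose s := undup (r ++ comps (nboxes A)).
pose d b := ((if b \in r then c b else 0)
             - (if b \in comps (nboxes A) then descent_count b else 0))%R.
have da : d a = 0%R.
  apply: (@qF_free s); rewrite ?undup_uniq //.
  - apply/allP => b; rewrite mem_undup mem_cat mem_comps.
    by case/orP => [/(allP cr)|/andP[]].
  - move=> m; apply/eqP.
    under eq_bigr do rewrite mulrBl 2!(fun_if (fun x => x * _)%R) mul0r.
    rewrite sumrB !restr ?undup_uniq ?comps_uniq //; first by rewrite -rE skew_schur_count subrr.
    + by move=> b h; rewrite mem_undup mem_cat h orbT.
    + by move=> b h; rewrite mem_undup mem_cat h.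
  - by rewrite mem_undup mem_cat ar.
move: da; rewrite /d ar => /eqP; rewrite subr_eq0 => /eqP cE; move: ca.
rewrite cE; case: ifP => // _; rewrite /descent_count ltr0n => /card_gt0P[T].
by rewrite inE => /andP[ST /eqP Ta]; exists T.
Qed.

End Support.

(** * Standard Young tableaux and runs of their descent sets *)

Section Tableaux.

Variable A : skew_shape.
Implicit Types (x y : box A) (T : filling A).

Lemma box_eq x y : boxrow x = boxrow y -> boxcol x = boxcol y -> x = y.
Proof.
case: x y => [[i j] h] [[i' j'] h'] /= ii jj.
by apply: val_inj; congr pair; apply: val_inj.
Qed.

Lemma boxP x : in_shape A (boxrow x) (boxcol x).
Proof. exact: valP x. Qed.

Lemma box_exists i j : in_shape A i j ->
  exists2 x : box A, boxrow x = i & boxcol x = j.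
Proof.
move=> h; have jA : j < ncols A by have := outer_ncols A i; move: h; rewrite /in_shape; lia.
have iA : i < nrows A.
  by case: (ltnP i (nrows A)) h => // /outer_nrows; rewrite /in_shape => ->; lia.
by exists (Sub (Ordinal iA, Ordinal jA) h).
Qed.

Lemma entry_bound T x : 0 < entry T x <= nboxes A.
Proof. exact: ltn_ord. Qed.

Lemma entry_inj T : is_SYT T -> injective (entry T).
Proof. by case/and3P => /injectiveP iT _ _ x y [] /val_inj/iT. Qed.

Lemma SYT_bij T : is_SYT T -> bijective T.
Proof.
by case/and3P => /injectiveP iT _ _; apply: inj_card_bij iT _; rewrite card_ord.
Qed.

Lemma entry_surj T v : is_SYT T -> 0 < v <= nboxes A -> exists x, entry T x = v.
Proof.
move=> /SYT_bij[g _ gK] vn; have vn' : v.-1 < nboxes A by lia.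
by exists (g (Ordinal vn')); rewrite /entry gK /=; lia.
Qed.

Lemma entry_row_lt T x y : is_SYT T ->
  boxrow x = boxrow y -> boxcol x < boxcol y -> entry T x < entry T y.
Proof.
by case/and3P => _ /forallP/(_ x)/forallP/(_ y) + _ rxy cxy; rewrite rxy eqxx cxy.
Qed.

Lemma entry_col_lt T x y : is_SYT T ->
  boxcol x = boxcol y -> boxrow x < boxrow y -> entry T x < entry T y.
Proof.
by case/and3P => _ _ /forallP/(_ x)/forallP/(_ y) + cxy rxy; rewrite cxy eqxx rxy.
Qed.

Lemma is_descentE T x y : is_SYT T -> entry T y = (entry T x).+1 ->
  is_descent T (entry T x) = (boxrow x < boxrow y).
Proof.
move=> ST exy; apply/existsP/idP => [[x' /existsP[y' /and3P[/eqP ex /eqP ey rxy]]]|rxy].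
  by rewrite -(entry_inj ST ex) -(entry_inj ST (etrans ey (esym exy))).
by exists x; apply/existsP; exists y; rewrite exy !eqxx.
Qed.

Lemma mem_descents T x y : is_SYT T -> entry T y = (entry T x).+1 ->
  (entry T x \in descents T) = (boxrow x < boxrow y).
Proof.
move=> ST exy; rewrite mem_filter (is_descentE ST exy) andb_idr // => _.
by rewrite mem_iota; have := entry_bound T y; have := entry_bound T x; lia.
Qed.

(** Each descent moves strictly down, so a run of descents fills a vertical strip; the induction is
    on the larger entry. *)
Lemma row_descent_run T x y : is_SYT T -> entry T x < entry T y ->
    (forall v, entry T x <= v < entry T y -> v \in descents T) ->
  boxrow x < boxrow y.
Proof.
move=> ST; move: {2}(entry T y) (erefl (entry T y)) => n.
elim: n y => [|n IH] y ey; first lia.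
rewrite ey ltnS => xn D; have [z ez] : exists z, entry T z = n.
  by apply: entry_surj => //; have := entry_bound T y; have := entry_bound T x; lia.
have zy : boxrow z < boxrow y by rewrite -(mem_descents ST) ?ez // D // xn ltnSn.
move: xn; rewrite leq_eqVlt => /orP[/eqP exn|xn].
  by rewrite (entry_inj ST (etrans exn (esym ez))).
by apply: ltn_trans zy; apply: IH; rewrite ?ez // => v hv; apply: D; lia.
Qed.

Lemma row_ascent_run T x y : is_SYT T -> entry T x < entry T y ->
    (forall v, entry T x <= v < entry T y -> v \notin descents T) ->
  boxrow y <= boxrow x.
Proof.
move=> ST; move: {2}(entry T y) (erefl (entry T y)) => n.
elim: n y => [|n IH] y ey; first lia.
rewrite ey ltnS => xn D; have [z ez] : exists z, entry T z = n.
  by apply: entry_surj => //; have := entry_bound T y; have := entry_bound T x; lia.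
have zy : boxrow y <= boxrow z by rewrite leqNgt -(mem_descents ST) ?ez // D // xn ltnSn.
move: xn; rewrite leq_eqVlt => /orP[/eqP exn|xn].
  by rewrite (entry_inj ST (etrans exn (esym ez))).
by apply: leq_trans zy _; apply: IH; rewrite ?ez // => v hv; apply: D; lia.
Qed.

(** Standardization: the entry of a box is the rank of its key. *)
Lemma SYT_of_key (key : box A -> nat) : injective key ->
    (forall x y, boxrow x = boxrow y -> boxcol x < boxcol y -> key x < key y) ->
    (forall x y, boxcol x = boxcol y -> boxrow x < boxrow y -> key x < key y) ->
  exists2 T, is_SYT T & forall x y, (entry T x < entry T y) = (key x < key y).
Proof.
move=> ki kr kc; pose below x := [set y | key y < key x].
have below_lt x y : key x < key y -> #|below x| < #|below y|.
  move=> xy; apply/proper_card/properP; split.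
    by apply/subsetP => z; rewrite !inE => /ltn_trans; apply.
  by exists x; rewrite !inE // ltnn.
have bn x : #|below x| < nboxes A.
  rewrite /nboxes -cardsT; apply/proper_card/properP; split; first exact: subsetT.
  by exists x; rewrite !inE // ltnn.
pose T : filling A := [ffun x => Ordinal (bn x)].
have TE x y : (entry T x < entry T y) = (key x < key y).
  rewrite /entry !ffunE ltnS /=; case: (ltngtP (key x) (key y)) => [/below_lt//|/below_lt|/ki ->].
  - by move=> h; apply/negbTE; rewrite -leqNgt ltnW.
  - by rewrite ltnn.
exists T => //; apply/and3P; split.
- apply/injectiveP => x y xy; apply: ki.
  by have := TE x y; have := TE y x; rewrite /entry xy ltnn; case: ltngtP.
- apply/forallP => x; apply/forallP => y; apply/implyP => /andP[/eqP rxy cxy].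
  by rewrite TE kr.
- apply/forallP => x; apply/forallP => y; apply/implyP => /andP[/eqP cxy rxy].
  by rewrite TE kc.
Qed.

End Tableaux.

(** * The greedy filling *)

Lemma digits_inj M a b a' b' : b < M -> b' < M ->
  a * M + b = a' * M + b' -> a = a' /\ b = b'.
Proof.
by move=> bM bM' e; case: (ltngtP a a') => [h|h|aa]; last split; nia.
Qed.

Section GreedyFilling.

Variables (B : skew_shape) (k l : nat).
Implicit Types x y : box B.

(* Row of the topmost box of column [j] once the [l] leftmost boxes of every
   row are removed. *)
Definition top j := find (fun i => nth 0 (inner B) i + l <= j) (iota 0 (nrows B)).

(** [inner] decreases, so the inequality persists below the first row where it holds. *)
Lemma topP i j : i < nrows B -> (nth 0 (inner B) i + l <= j) = (top j <= i).
Proof.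
move=> iB; set P := fun i => nth 0 (inner B) i + l <= j.
case: (leqP (top j) i) => [ti|/(before_find 0)]; last by rewrite nth_iota.
have hP : has P (iota 0 (nrows B)) by rewrite has_find size_iota (leq_ltn_trans ti).
have tB : top j < nrows B by rewrite (leq_ltn_trans ti).
have := nth_find 0 hP; rewrite nth_iota // add0n /P -/(top j).
by have := leq_inner B ti; lia.
Qed.

Lemma top_antitone j j' : j <= j' -> top j' <= top j.
Proof.
move=> jj; case: (ltnP (top j) (nrows B)) => tB.
  by have := topP j tB; rewrite leqnn -(topP _ tB); lia.
by apply: leq_trans tB; rewrite -[X in _ <= X](size_iota 0) find_size.
Qed.

(* Here [k] and [l] are one less than the height and width of the rectangles.
   The boxes of stages [0, ..., l - 1] are the leftmost boxes of the rows; those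
   of stages [l, ..., l + k - 1] are the topmost boxes of the columns of what
   remains; stage [l + k] is the rest. *)
Definition stage x :=
  let a := boxcol x - nth 0 (inner B) (boxrow x) in
  if a < l then a else l + minn k (boxrow x - top (boxcol x)).

(** A lexicographic order written in base [M], which exceeds all coordinates: by stage, then by row
    in the first [l] stages and by column in the later ones. *)
Definition key x : nat :=
  let M := nrows B + ncols B in
  stage x * (M * M) +
  (if stage x < l then boxrow x * M + boxcol x else boxcol x * M + boxrow x).

Lemma box_bounds x : boxrow x < nrows B /\ boxcol x < ncols B.
Proof. by split; apply: ltn_ord. Qed.

Lemma key_stage x y : key x < key y -> stage x <= stage y.
Proof.
have [rx cx] := box_bounds x; have [ry cy] := box_bounds y.
rewrite /key; case: (leqP (stage x) (stage y)) => // h.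
set M := nrows B + ncols B.
have t z : boxrow z < nrows B -> boxcol z < ncols B ->
  (if stage z < l then boxrow z * M + boxcol z else boxcol z * M + boxrow z) < M * M.
  by case: ifP => _ *; rewrite /M; nia.
by have := t y ry cy; have := t x rx cx; nia.
Qed.

Lemma key_ltn_stage x y : stage x < stage y -> key x < key y.
Proof.
move=> h; have [rx cx] := box_bounds x.
have t : (if stage x < l then boxrow x * (nrows B + ncols B) + boxcol x
          else boxcol x * (nrows B + ncols B) + boxrow x)
         < (nrows B + ncols B) * (nrows B + ncols B).
  by case: ifP => _; nia.
rewrite /key; nia.
Qed.

(** In the first [l] stages a row has at most one box per stage; afterwards the stage weakly
    increases because [top] is antitone. *)
Lemma stage_row x y : boxrow x = boxrow y -> boxcol x < boxcol y ->
  stage x < stage y \/ stage x = stage y /\ l <= stage x.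
Proof.
move=> rxy cxy; have := boxP x; have := boxP y; rewrite /in_shape /stage rxy.
have := top_antitone (ltnW cxy); set tx := top (boxcol x); set ty := top (boxcol y).
by case: ifP; case: ifP; lia.
Qed.

(** A column may repeat a stage inside a vertical strip or in the rest, but each horizontal strip
    takes at most one box from it. *)
Lemma stage_col x y : boxcol x = boxcol y -> boxrow x < boxrow y ->
  stage x < stage y \/ stage x = stage y /\ ~~ (l <= stage x < l + k).
Proof.
move=> cxy rxy; have := boxP x; have := boxP y; rewrite /in_shape /stage cxy.
have [rx _] := box_bounds x; have [ry _] := box_bounds y.
have := leq_inner B (ltnW rxy); have := topP (boxcol y) rx; have := topP (boxcol y) ry.
set t := top (boxcol y).
by case: ifP; case: ifP; lia.
Qed.

Lemma key_row x y : boxrow x = boxrow y -> boxcol x < boxcol y -> key x < key y.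
Proof.
move=> rxy cxy; case: (stage_row rxy cxy) => [/key_ltn_stage//|[sE sl]].
rewrite /key -sE [stage x < l]ltnNge sl /= rxy; have [ry cy] := box_bounds y; nia.
Qed.

Lemma key_col x y : boxcol x = boxcol y -> boxrow x < boxrow y -> key x < key y.
Proof.
move=> cxy rxy; case: (stage_col cxy rxy) => [/key_ltn_stage//|[sE sl]].
have [rx _] := box_bounds x; have [ry _] := box_bounds y.
by rewrite /key -sE cxy; case: ifP => _; nia.
Qed.

Lemma key_inj : injective key.
Proof.
move=> x y kxy; have sxy : stage x = stage y.
  by case: (ltngtP (stage x) (stage y)) => // /key_ltn_stage; rewrite kxy ltnn.
have [rx cx] := box_bounds x; have [ry cy] := box_bounds y.
move: kxy; rewrite /key sxy => /addnI.
case: ifP => _ /(digits_inj _ _)[||? ?]; try lia; exact: box_eq.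
Qed.

Lemma stage_vertical x y : stage x = stage y -> stage x < l -> key x < key y ->
  boxrow x < boxrow y.
Proof.
move=> sxy sl; rewrite /key -sxy sl ltn_add2l => h.
have [rx cx] := box_bounds x; have [ry cy] := box_bounds y.
have rxy : boxrow x <= boxrow y by nia.
case: (ltngtP (boxrow x) (boxrow y)) rxy => // rxy _.
have cxy : boxcol x < boxcol y by move: h; rewrite rxy; lia.
by case: (stage_row rxy cxy); lia.
Qed.

(** In such a stage the row is [top] of the column plus a constant, and [top] is antitone. *)
Lemma stage_horizontal x y : stage x = stage y -> l <= stage x < l + k ->
  key x < key y -> boxrow y <= boxrow x.
Proof.
move=> sxy /andP[sl sk]; rewrite /key -sxy [stage x < l]ltnNge sl /= ltn_add2l => h.
have [rx cx] := box_bounds x; have [ry cy] := box_bounds y.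
have cxy : boxcol x <= boxcol y by nia.
have := top_antitone cxy; move: sxy sl sk; rewrite /stage.
have := boxP x; have := boxP y; rewrite /in_shape.
have := topP (boxcol x) rx; have := topP (boxcol y) ry.
by case: ifP; case: ifP; lia.
Qed.

(** Going [k] rows up and [l] columns left from a box of the last stage stays inside [B]. No
    subtraction is truncated there, so [f] is injective on that stage. *)
Lemma card_last_stage : #|[set x | stage x == l + k]| <= rects k.+1 l.+1 B.
Proof.
pose f x : 'I_(nrows B) * 'I_(ncols B) :=
  (Ordinal (leq_ltn_trans (leq_subr k _) (ltn_ord (val x).1)),
   Ordinal (leq_ltn_trans (leq_subr l _) (ltn_ord (val x).2))).
have last_stage x : stage x = l + k ->
    [/\ k <= boxrow x, l <= boxcol x & is_rect B k.+1 l.+1 (boxrow x - k) (boxcol x - l)].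
  have [rx cx] := box_bounds x.
  have := boxP x; rewrite /in_shape is_rectE // /stage => sh sx.
  have rkx : boxrow x - k < nrows B by lia.
  have tx := topP (boxcol x) rx; have tkx := topP (boxcol x) rkx.
  have [kr lc] : k <= boxrow x /\ l <= boxcol x by move: sx; case: ifP; lia.
  by split=> //; rewrite /= !subnK //; move: sx; case: ifP; lia.
rewrite -(@card_in_imset _ _ f).
  apply/subset_leq_card/subsetP => p /imsetP[x]; rewrite inE => /eqP/last_stage[_ _ rx] ->.
  by rewrite inE.
move=> x y; rewrite !inE => /eqP/last_stage[kx lx _] /eqP/last_stage[ky ly _] e.
have rxy : boxrow x - k = boxrow y - k := congr1 (fun p => nat_of_ord p.1) e.
have cxy : boxcol x - l = boxcol y - l := congr1 (fun p => nat_of_ord p.2) e.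
by apply: box_eq; lia.
Qed.

End GreedyFilling.

(** * Transfer of the stages of [B] to a tableau of [A] with the same descents *)

Section Comparison.

Variables (A B : skew_shape) (k l : nat) (S : filling B) (T : filling A).
Hypotheses (SYT_S : is_SYT S) (SYT_T : is_SYT T).
Hypotheses (eqn : nboxes A = nboxes B) (eqD : descents T = descents S).
Hypothesis key_S : forall x y, (entry S x < entry S y) = (key k l x < key k l y).

(** The stage of the box of [S] containing [v], as a running maximum: monotone by construction and
    defined for every [v]. *)
Definition entry_stage v := \max_(x : box B | entry S x <= v) stage k l x.

Lemma leq_entry_stage v w : v <= w -> entry_stage v <= entry_stage w.
Proof.
move=> vw; apply/bigmax_leqP => x xv; apply: (leq_bigmax_cond x).
exact: leq_trans xv vw.
Qed.

Lemma entry_stageE x : entry_stage (entry S x) = stage k l x.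
Proof.
apply/eqP; rewrite eqn_leq (leq_bigmax_cond x) // andbT.
apply/bigmax_leqP => y; rewrite leq_eqVlt => /orP[/eqP/(entry_inj SYT_S) ->//|].
by rewrite key_S => /key_stage.
Qed.

Lemma stage_descent v : 0 < v < nboxes B -> entry_stage v = entry_stage v.+1 ->
  (entry_stage v < l -> v \in descents S)
  /\ (l <= entry_stage v < l + k -> v \notin descents S).
Proof.
move=> /andP[v0 vn].
have [x xv] : exists x, entry S x = v by apply: entry_surj => //; lia.
have [y yv] : exists y, entry S y = v.+1 by apply: entry_surj.
have kxy : key k l x < key k l y by rewrite -key_S xv yv.
have eyx : entry S y = (entry S x).+1 by rewrite yv xv.
rewrite -yv -xv !entry_stageE (mem_descents SYT_S eyx) => sxy; split=> h.
  by apply: stage_vertical h kxy.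
by rewrite -leqNgt; apply: stage_horizontal h kxy.
Qed.

(** With equal stages, the entries from that of [x] to that of [y] would form a run of descents of
    [S], hence of [T], putting [y] strictly below [x]. *)
Lemma stage_row_step (x y : box A) : boxrow x = boxrow y -> boxcol x < boxcol y ->
  entry_stage (entry T x) < l -> entry_stage (entry T x) < entry_stage (entry T y).
Proof.
move=> rxy cxy sl; have exy := entry_row_lt SYT_T rxy cxy.
have := leq_entry_stage (ltnW exy); rewrite leq_eqVlt => /orP[/eqP sxy|//].
suff : boxrow x < boxrow y by rewrite rxy ltnn.
apply: (row_descent_run SYT_T exy) => v /andP[xv vy].
have s1 := leq_entry_stage xv; have s2 := leq_entry_stage (leqnSn v).
have s3 := leq_entry_stage vy; have := entry_bound T x; have := entry_bound T y.
by rewrite eqD eqn => hy hx; apply: (stage_descent _ _).1; lia.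
Qed.

(** With equal stages there would be no descent between the two entries, so [y] could not be below
    [x]. *)
Lemma stage_col_step (x y : box A) : boxcol x = boxcol y -> boxrow x < boxrow y ->
    l <= entry_stage (entry T x) < l + k ->
  entry_stage (entry T x) < entry_stage (entry T y).
Proof.
move=> cxy rxy sl; have exy := entry_col_lt SYT_T cxy rxy.
have := leq_entry_stage (ltnW exy); rewrite leq_eqVlt => /orP[/eqP sxy|//].
suff : boxrow y <= boxrow x by rewrite leqNgt rxy.
apply: (row_ascent_run SYT_T exy) => v /andP[xv vy].
have s1 := leq_entry_stage xv; have s2 := leq_entry_stage (leqnSn v).
have s3 := leq_entry_stage vy; have := entry_bound T x; have := entry_bound T y.
by rewrite eqD eqn => hy hx; apply: (stage_descent _ _).2; lia.
Qed.

(* Of the [l + 1] boxes of the top row, at most [l] have stage less than [l];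
   hence the last column starts at stage at least [l], and then goes through
   distinct stages until it reaches the last one. *)
Lemma rect_corner_stage i j (x : box A) : is_rect A k.+1 l.+1 i j ->
  boxrow x = i + k -> boxcol x = j + l -> l + k <= entry_stage (entry T x).
Proof.
rewrite is_rectE //= => /andP[ij ijo] rx cx.
have inA i' j' : i <= i' <= i + k -> j <= j' <= j + l -> in_shape A i' j'.
  move=> /andP[/(leq_inner A) + /(leq_outer A)] ?; rewrite /in_shape; lia.
have row a : a <= l -> forall z : box A, boxrow z = i -> boxcol z = j + a ->
    a <= entry_stage (entry T z).
  elim: a => // a IH al z rz cz; have [|y ry cy] := @box_exists A i (j + a).
    by apply: inA; lia.
  have ryz : boxrow y = boxrow z by rewrite ry.
  have cyz : boxcol y < boxcol z by lia.
  have := IH (ltnW al) y ry cy; have := stage_row_step ryz cyz.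
  by have := leq_entry_stage (ltnW (entry_row_lt SYT_T ryz cyz)); lia.
suff col b : b <= k -> forall z : box A, boxrow z = i + b -> boxcol z = j + l ->
    l + b <= entry_stage (entry T z) by apply: col.
elim: b => [|b IH] bk z rz cz; first by rewrite addn0; apply: row; rewrite ?rz ?addn0.
have [|y ry cy] := @box_exists A (i + b) (j + l); first by apply: inA; lia.
have cyz : boxcol y = boxcol z by rewrite cy.
have ryz : boxrow y < boxrow z by lia.
have := IH (ltnW bk) y ry cy; have := stage_col_step cyz ryz.
by have := leq_entry_stage (ltnW (entry_col_lt SYT_T cyz ryz)); lia.
Qed.

Lemma rects_leq : rects k.+1 l.+1 A <= rects k.+1 l.+1 B.
Proof.
apply: leq_trans (card_last_stage B k l).
(* [h y] is the box of [A] whose entry in [T] is that of [y] in [S]. *)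
have [g gK _] := SYT_bij SYT_T; pose h y := g (cast_ord (esym eqn) (S y)).
pose f (y : box B) : 'I_(nrows A) * 'I_(ncols A) :=
  (Ordinal (leq_ltn_trans (leq_subr k _) (ltn_ord (val (h y)).1)),
   Ordinal (leq_ltn_trans (leq_subr l _) (ltn_ord (val (h y)).2))).
(* Every rectangle of [A] is the image under [f] of the box of [B] that has the entry of its bottom
   right corner; that box is in the last stage. *)
apply: leq_trans (leq_imset_card f _); apply/subset_leq_card/subsetP => -[i j].
rewrite inE => rij'; have rij : is_rect A k.+1 l.+1 i j := rij'.
have [x rx cx] : exists2 x : box A, boxrow x = i + k & boxcol x = j + l.
  apply: box_exists; move: (rij); rewrite is_rectE //= /in_shape.
  by have := leq_inner A (leq_addr k i); lia.
have [y yx] : exists y, entry S y = entry T x.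
  by apply: entry_surj => //; have := entry_bound T x; rewrite eqn.
have hyx : h y = x.
  by rewrite /h -[RHS]gK; congr g; apply: val_inj; case: yx.
have /eqP sy : stage k l y == l + k.
  rewrite eqn_leq -[in X in _ && X]entry_stageE yx (rect_corner_stage rij rx cx) andbT.
  by rewrite /stage; case: ifP; lia.
apply/imsetP; exists y; first by rewrite inE sy.
rewrite /f hyx; congr pair; apply: val_inj => /=.
- by rewrite -[LHS](addnK k) -rx.
- by rewrite -[LHS](addnK l) -cx.
Qed.

End Comparison.

Theorem theorem4p1 (A B : skew_shape) :
  (rows_cond A B <-> cols_cond A B) /\
  (cols_cond A B <-> rects_cond A B) /\
  ((forall a : seq nat, supp_F B a -> supp_F A a) ->
     rows_cond A B /\ cols_cond A B /\ rects_cond A B).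
Proof.
split; first by rewrite rows_condP cols_condP.
split; first exact: cols_condP.
move=> sBA; rewrite rows_condP cols_condP; suff : rects_cond A B by [].
move=> [|k] [|l] // _ _.
have [S SS keyS] := SYT_of_key (@key_inj B k l) (@key_row B k l) (@key_col B k l).
have [|T ST TS] := (supp_FP A (descent_comp S)).1.
  by apply/sBA/supp_FP; exists S.
have [_ nT cT] := descent_compP T; have [_ nS cS] := descent_compP S.
(* The descent composition determines the number of boxes, as its sum, and the descent set, as its
   [comp_set]. *)
by apply: (@rects_leq _ _ _ _ S T) => //; rewrite -?nT -?nS -?cT -?cS TS.
Qed.
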